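(* Let $k$ be a field, let $a\ge 1$, $d\ge 1$ and $b\in\{1,2,3\}$ be integers, put $m_0=3a+b$, $m_i=m_0+id$ for $i=1,2,3$, and assume $\gcd(m_0,m_1,m_2,m_3)=1$. Let $A=k[[t^{m_0},t^{m_1},t^{m_2},t^{m_3}]]$ with maximal ideal $m=(t^{m_0},t^{m_1},t^{m_2},t^{m_3})$, and let $G=\bigoplus_{i\ge 0}m^i/m^{i+1}$ be its associated graded ring, with Hilbert function $H_G(i)=\dim_k(m^i/m^{i+1})$. Then for all integers $i\ge 0$: if $b=1$, $$H_G(i)=\binom{i+3}{3}-3\binom{i+1}{3}-3\binom{i-a+2}{3}+2\binom{i}{3}+6\binom{i-a+1}{3}-3\binom{i-a}{3};$$ if $b=2$, $$H_G(i)=\binom{i+3}{3}-3\binom{i+1}{3}-2\binom{i-a+2}{3}+2\binom{i}{3}+3\binom{i-a+1}{3}-\binom{i-a-1}{3};$$ if $b=3$, $$H_G(i)=\binom{i+3}{3}-3\binom{i+1}{3}-\binom{i-a+2}{3}+2\binom{i}{3}+3\binom{i-a}{3}-2\binom{i-a-1}{3}.$$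
   Context: Convention: $\binom{n}{3}=0$ for every integer $n<3$, including negative $n$. *)

(* Defs.v *)
From HB Require Import structures.
From mathcomp Require Import all_boot all_order all_algebra.
From mathcomp Require Import all_classical.

Set Implicit Arguments.
Unset Strict Implicit.
Unset Printing Implicit Defensive.

Import GRing.Theory.
Local Open Scope ring_scope.
Local Open Scope classical_set_scope.

(** [fps R] is the ring R[[t]]: [f n] is the coefficient of t^n. The alias keeps
    the Cauchy product apart from the pointwise product on [nat -> R]. *)
Definition fps (R : comNzRingType) : Type := nat -> R.

Section FpsRing.
Variable R : comNzRingType.
Implicit Types f g h : fps R.

HB.instance Definition _ := Choice.copy (fps R) (nat -> R).

Definition fps_zero : fps R := fun=> 0.
Definition fps_opp f : fps R := fun n => - f n.
Definition fps_add f g : fps R := fun n => f n + g n.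
Definition fps_one : fps R := fun n => (n == 0)%:R.
Definition fps_mul f g : fps R := fun n => \sum_(i < n.+1) f i * g (n - i)%N.
Definition fps_scale (c : R) f : fps R := fun n => c * f n.

Fact fps_addA : associative fps_add.
Proof. by move=> f g h; apply/funext => n; exact: addrA. Qed.
Fact fps_addC : commutative fps_add.
Proof. by move=> f g; apply/funext => n; exact: addrC. Qed.
Fact fps_add0 : left_id fps_zero fps_add.
Proof. by move=> f; apply/funext => n; exact: add0r. Qed.
Fact fps_addN : left_inverse fps_zero fps_opp fps_add.
Proof. by move=> f; apply/funext => n; exact: addNr. Qed.

HB.instance Definition _ :=
  GRing.isZmodule.Build (fps R) fps_addA fps_addC fps_add0 fps_addN.

(* The ring laws are transferred from {poly R} through truncation. *)
Definition fps_trunc N f : {poly R} := \poly_(i < N.+1) f i.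

Fact coef_fps_trunc N f n : (n <= N)%N -> (fps_trunc N f)`_n = f n.
Proof. by move=> le_nN; rewrite coef_poly ltnS le_nN. Qed.

Fact fps_mul_coef N f g n : (n <= N)%N ->
  fps_mul f g n = (fps_trunc N f * fps_trunc N g)`_n.
Proof.
move=> le_nN; rewrite coefM; apply: eq_bigr => i _.
rewrite !coef_fps_trunc //; first exact: leq_trans (leq_subr _ _) le_nN.
exact: leq_trans (leq_ord i) le_nN.
Qed.

Fact fps_mulA : associative fps_mul.
Proof.
move=> f g h; apply/funext => n.
transitivity ((fps_trunc n f * fps_trunc n g * fps_trunc n h)`_n).
  rewrite -mulrA coefM; apply: eq_bigr => i _.
  by rewrite coef_fps_trunc ?leq_ord // -fps_mul_coef ?leq_subr.
rewrite coefM; apply: eq_bigr => i _.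
by rewrite coef_fps_trunc ?leq_subr // -fps_mul_coef ?leq_ord.
Qed.

Fact fps_mulC : commutative fps_mul.
Proof.
by move=> f g; apply/funext => n; rewrite !(fps_mul_coef _ _ (leqnn n)) mulrC.
Qed.

Fact fps_mul1 : left_id fps_one fps_mul.
Proof.
move=> f; apply/funext => n; rewrite /fps_mul big_ord_recl subn0 mul1r.
by rewrite big1 ?addr0 // => i _; rewrite mul0r.
Qed.

Fact fps_mulDl : left_distributive fps_mul +%R.
Proof.
move=> f g h; apply/funext => n; rewrite [RHS]/(fps_add _ _ n) -big_split.
by apply: eq_bigr => i _; exact: mulrDl.
Qed.

Fact fps_one_neq0 : fps_one != 0.
Proof. by apply/eqP => /(congr1 (fun f => f 0)) /eqP; rewrite oner_eq0. Qed.

HB.instance Definition _ := GRing.Zmodule_isComNzRing.Build (fps R)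
  fps_mulA fps_mulC fps_mul1 fps_mulDl fps_one_neq0.

Fact fps_scaleA c1 c2 f :
  fps_scale c1 (fps_scale c2 f) = fps_scale (c1 * c2) f.
Proof. by apply/funext => n; exact: mulrA. Qed.
Fact fps_scale1 : left_id 1 fps_scale.
Proof. by move=> f; apply/funext => n; exact: mul1r. Qed.
Fact fps_scaleDr : right_distributive fps_scale +%R.
Proof. by move=> c f g; apply/funext => n; exact: mulrDr. Qed.
Fact fps_scaleDl f : {morph fps_scale^~ f : c1 c2 / c1 + c2}.
Proof. by move=> c1 c2; apply/funext => n; exact: mulrDl. Qed.

HB.instance Definition _ := GRing.Zmodule_isLmodule.Build R (fps R)
  fps_scaleA fps_scale1 fps_scaleDr fps_scaleDl.

Fact fps_scaleAl c f g : c *: (f * g) = (c *: f) * g.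
Proof.
apply/funext => n.
transitivity (c * \sum_(i < n.+1) f i * g (n - i)%N); first by [].
rewrite mulr_sumr.
by apply: eq_bigr => i _; exact: mulrA.
Qed.

HB.instance Definition _ :=
  GRing.Lmodule_isLalgebra.Build R (fps R) fps_scaleAl.
HB.instance Definition _ := GRing.Lalgebra_isComAlgebra.Build R (fps R).

Definition fpsX : fps R := fun n => (n == 1)%:R.

End FpsRing.

Arguments fpsX {R}.

(** R[[t^(m 0), ..., t^(m (r-1))]]: the image in R[[t]] of the power series ring
    in r variables under X_j |-> t^(m j). The series with coefficients [g u],
    for u : 'I_r -> nat, is sent to the series whose n-th coefficient is the sum
    of the [g u] such that \sum_j u j * m j = n. This is meant for positive
    exponents [m j]: such u then satisfy u j <= n, whence the finite index
    type of the sum. *)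
Definition fps_subring (R : comNzRingType) (r : nat) (m : 'I_r -> nat) :
    set (fps R) :=
  [set f : fps R | exists g : {ffun 'I_r -> nat} -> R, forall n : nat,
     f n = \sum_(u : {ffun 'I_r -> 'I_n.+1} | (\sum_j u j * m j)%N == n)
              g [ffun j => nat_of_ord (u j)]].

Section Ideals.
Variables (B : comNzRingType) (A : set B).

(** In what follows A is a subring of B, and ideals of A are subsets of B. *)
Definition ideal_span (S : set B) : set B :=
  [set x | exists (n : nat) (a s : 'I_n -> B),
     [/\ forall j, A (a j), forall j, S (s j) & x = \sum_j a j * s j]].

Definition ideal_mul (I J : set B) : set B :=
  ideal_span [set x | exists2 y, I y & exists2 z, J z & x = y * z].

Fixpoint ideal_pow (I : set B) (n : nat) : set B :=
  if n is n'.+1 then ideal_mul I (ideal_pow I n') else A.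

End Ideals.

(** dim_k (U / W) = n, for subspaces W of U in V: some n vectors of U form a
    basis of U modulo W. *)
Definition quot_dim (k : fieldType) (V : lmodType k) (U W : set V) (n : nat) :
    Prop :=
  exists e : 'I_n -> V,
    [/\ forall j, U (e j),
        forall c : 'I_n -> k, W (\sum_j c j *: e j) -> forall j, c j = 0
      & forall x, U x -> exists c : 'I_n -> k, W (x - \sum_j c j *: e j)].

Definition gen_exp (a b d : nat) (j : nat) : nat := (3 * a + b + j * d)%N.

Definition arith_ring (k : fieldType) (a b d : nat) : set (fps k) :=
  fps_subring (fun j : 'I_4 => gen_exp a b d j).
Arguments arith_ring : clear implicits.

Definition arith_max (k : fieldType) (a b d : nat) : set (fps k) :=
  ideal_span (arith_ring k a b d)
    [set f | exists j : 'I_4, f = fpsX ^+ gen_exp a b d j].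
Arguments arith_max : clear implicits.

(** H_G(i) = h, where H_G(i) is dim_k (m^i / m^(i+1)). *)
Definition hilbert_value (k : fieldType) (a b d i h : nat) : Prop :=
  let m_pow := ideal_pow (arith_ring k a b d) (arith_max k a b d) in
  quot_dim (m_pow i) (m_pow i.+1) h.

(** binom(z, 3), with value 0 for every z < 3, including negative z. *)
Definition binz3 (z : int) : int := if z is Posz n then ('C(n, 3))%:Z else 0.

(* Main.v *)
Require Import Defs.
From mathcomp Require Import all_boot all_order all_algebra.
From mathcomp Require Import all_classical.
From mathcomp Require Import zify.

Set Implicit Arguments.
Unset Strict Implicit.
Unset Printing Implicit Defensive.

Import GRing.Theory.
Local Open Scope ring_scope.
Local Open Scope classical_set_scope.

(** Write m0 = 3a + b. A sum of s of the generators m0 + jd (0 <= j <= 3) is a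
    number s m0 + t d with 0 <= t <= 3s, and every such number occurs. A power of
    the maximal ideal is determined by supports: m^i is the set of all series
    supported on the numbers that are sums of at least i generators. This holds
    for the semigroup ring of any positive generators ([ideal_powE]),
    because a series whose exponents are all sums of at least i + 1 generators
    splits into finitely many pieces, one for each
    generator that can be taken off ([supported_decomp]).

    Hence dim m^i/m^(i+1) counts the numbers that are a sum of i generators but
    of no more. As gcd(m0, d) = 1, two expressions s m0 + t d of one number
    differ by a multiple of (d, -m0) in (s, t); so the length s is maximal
    exactly when t < m0. The numbers counted are thus i m0 + t d with t <= 3i and
    t < m0, and H_G(i) = min(3i + 1, m0) ([hilbert_value_arith]).

    The binomial expressions are this minimum in disguise: the terms without a
    add up to 3i + 1, the Hilbert function of the twisted cubic, and the others
    vanish for i <= a and add up to 3a + b - (3i + 1) for i > a. This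
    is checked by substituting 6 binom(z, 3) = z (z - 1) (z - 2) for z >= 0 and
    binom(z, 3) = 0 for z < 3. *)

(** * Power series with prescribed support *)

Section Support.
Variable R : comNzRingType.
Implicit Types (f g : fps R) (P Q : nat -> Prop).

Definition supported P : set (fps R) := [set f | forall n, f n != 0 -> P n].

Lemma fps_coefD f g n : (f + g) n = f n + g n. Proof. by []. Qed.

Lemma fps_coefM f g n : (f * g) n = \sum_(i < n.+1) f i * g (n - i)%N.
Proof. by []. Qed.

Lemma fps_coef_sum I (s : seq I) (F : I -> fps R) n :
  (\sum_(i <- s) F i) n = \sum_(i <- s) F i n.
Proof. by elim/big_rec2: _ => // i x y _ <-. Qed.

Lemma fps_coefXM p f n :
  (fpsX ^+ p * f) n = if (p <= n)%N then f (n - p)%N else 0.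
Proof.
elim: p f n => [|p IH] f n; first by rewrite expr0 mul1r subn0.
rewrite exprS -mulrA fps_coefM; case: n => [|n].
  by rewrite big_ord_recl big_ord0 mul0r addr0.
rewrite !big_ord_recl big1 => [|j _]; last by rewrite mul0r.
rewrite /= mul0r mul1r add0r addr0.
by rewrite !subSS subn0 IH ltnS.
Qed.

Lemma fps_coefXn p n : (fpsX ^+ p : fps R) n = (n == p)%:R.
Proof.
rewrite -[_ ^+ _]mulr1 fps_coefXM -[(1 : fps R) _]/((n - p)%N == 0%N)%:R.
by rewrite subn_eq0 (eqn_leq n p) andbC; case: leqP.
Qed.

Lemma supportedD P f g : supported P f -> supported P g -> supported P (f + g).
Proof.
move=> Pf Pg n; rewrite fps_coefD.
by have [->|/Pf //] := eqVneq (f n) 0; rewrite add0r => /Pg.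
Qed.

Lemma supported_sum P I (s : seq I) (F : I -> fps R) :
  (forall i, supported P (F i)) -> supported P (\sum_(i <- s) F i).
Proof.
move=> PF; elim/big_ind: _ => // [n|f g]; first by rewrite eqxx.
exact: supportedD.
Qed.

Lemma supportedM P Q T f g : (forall p q, P p -> Q q -> T (p + q)%N) ->
  supported P f -> supported Q g -> supported T (f * g).
Proof.
move=> PQT Pf Qg n; rewrite fps_coefM => nz.
apply: contrapT => nT; case/eqP: nz; apply: big1 => i _.
have [->|/Pf Pi] := eqVneq (f i) 0; first by rewrite mul0r.
have [->|/Qg Qi] := eqVneq (g (n - i)%N) 0; first by rewrite mulr0.
by case: nT; rewrite -(subnKC (leq_ord i)); exact: PQT.
Qed.

Lemma supportedXn P p : P p -> supported P (fpsX ^+ p).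
Proof.
by move=> Pp n; rewrite fps_coefXn; case: (n =P p) => [->|] //; rewrite eqxx.
Qed.

End Support.

(** * Powers of the maximal ideal of a numerical semigroup ring *)

Section SemigroupRing.
Variables (R : comNzRingType) (r : nat) (m : 'I_r -> nat).

(** Words in the generators encode factorizations: prepending a letter is
    multiplication by a generator, and the length is the number of factors. *)
Definition sum_of_at_least i n :=
  exists2 w : seq 'I_r, (i <= size w)%N & n = (\sum_(j <- w) m j)%N.

Lemma sum_of_at_leastD i1 i2 p q : sum_of_at_least i1 p ->
  sum_of_at_least i2 q -> sum_of_at_least (i1 + i2) (p + q).
Proof.
move=> [w1 l1 ->] [w2 l2 ->]; exists (w1 ++ w2); last by rewrite big_cat.
by rewrite size_cat leq_add.
Qed.

Lemma sum_of_at_least_gen j : sum_of_at_least 1 (m j).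
Proof. by exists [:: j]; rewrite // big_seq1. Qed.

Lemma sum_of_at_leastS i n : sum_of_at_least i.+1 n ->
  exists j, (m j <= n)%N /\ sum_of_at_least i (n - m j).
Proof.
move=> [[//|j w]] lw ->; exists j; rewrite big_cons leq_addr addKn.
by split=> //; exists w.
Qed.

(** The vectors u are the exponents of the monomials in r variables through
    which the semigroup ring is defined; u counts the letters of a word. *)
Lemma sum_of_at_least0 n : sum_of_at_least 0 n <->
  exists u : {ffun 'I_r -> nat}, (\sum_j u j * m j)%N = n.
Proof.
split=> [[w _ ->]|[u <-]].
  exists [ffun j => count_mem j w].
  elim: w => [|x w IH].
    by rewrite big_nil big1 // => j _; rewrite ffunE.
  rewrite big_cons -IH (bigD1 x) //= [in RHS](bigD1 x) //= !ffunE /= eqxx.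
  rewrite mulnDl mul1n addnA; congr (_ + _)%N.
  by apply: eq_bigr => j /negPf jx; rewrite !ffunE /= eq_sym jx.
exists (flatten [seq nseq (u j) j | j <- index_enum 'I_r]) => //.
rewrite big_flatten big_map; apply: eq_bigr => j _.
by rewrite big_nseq iter_addn_0 mulnC.
Qed.

Hypothesis m_gt0 : forall j, (0 < m j)%N.

(** A preimage in the power series ring in r variables is obtained by choosing,
    for each n in the support, one single monomial of weight n. *)
Lemma fps_subringE : fps_subring m = supported (R := R) (sum_of_at_least 0).
Proof.
apply/seteqP; split=> f.
  move=> [g fE] n nz; apply/sum_of_at_least0; apply: contrapT => nex.
  case/eqP: nz; rewrite fE big_pred0 // => u; apply/negP => /eqP un.
  apply: nex; exists [ffun j => nat_of_ord (u j)]; apply: etrans un.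
  by apply: eq_bigr => j _; rewrite ffunE.
move=> Sf.
have /choice [W WE] n : exists u : {ffun 'I_r -> nat},
    f n != 0 -> (\sum_j u j * m j)%N = n.
  have [_|/Sf/sum_of_at_least0 [u un]] := eqVneq (f n) 0; last by exists u.
  by exists [ffun=> 0%N].
pose wt (u : {ffun 'I_r -> nat}) := (\sum_j u j * m j)%N.
exists (fun u => if u == W (wt u) then f (wt u) else 0) => n.
have wtE (u : {ffun 'I_r -> 'I_n.+1}) : (\sum_j u j * m j)%N == n ->
    wt [ffun j => nat_of_ord (u j)] = n.
  move/eqP=> un; apply: etrans un.
    by apply: eq_bigr => j _; rewrite ffunE.
rewrite (eq_bigr (fun u : {ffun 'I_r -> 'I_n.+1} =>
    if [ffun j => nat_of_ord (u j)] == W n then f n else 0)); last first.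
  by move=> u /wtE ->.
have [->|nz] := eqVneq (f n) 0; first by rewrite big1 // => u _; case: ifP.
have Wn := WE n nz.
have Wle j : (W n j < n.+1)%N.
  rewrite ltnS -[X in (_ <= X)%N]Wn (bigD1 j) //=.
  by apply: leq_trans (leq_addr _ _); rewrite leq_pmulr.
(* the chosen exponent W n is the only index with a nonzero contribution *)
pose u0 : {ffun 'I_r -> 'I_n.+1} := [ffun j => Ordinal (Wle j)].
have u0E : [ffun j => nat_of_ord (u0 j)] = W n.
  by apply/ffunP => j; rewrite !ffunE.
rewrite (bigD1 u0) /=; last first.
  by apply/eqP; apply: etrans Wn; apply: eq_bigr => j _; rewrite ffunE.
rewrite u0E eqxx big1 ?addr0 // => u /andP[_ /eqP uu0].
case: eqP => // uW; case: uu0; apply/ffunP => j; apply/val_inj.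
by move/ffunP/(_ j): uW; rewrite !ffunE.
Qed.

Let A : set (fps R) := fps_subring m.
Let M : set (fps R) := ideal_span A [set f | exists j, f = fpsX ^+ m j].

Lemma ideal_span_supported (S : set (fps R)) i :
  S `<=` supported (sum_of_at_least i) ->
  ideal_span A S `<=` supported (sum_of_at_least i).
Proof.
move=> SP x [n [c [s [Ac Ss ->]]]]; apply: supported_sum => j.
move: (Ac j) (SP _ (Ss j)); rewrite /A fps_subringE; apply: supportedM.
exact: sum_of_at_leastD.
Qed.

Lemma subring1 : A 1.
Proof.
rewrite /A fps_subringE; apply: (@supportedXn _ _ 0).
by exists [::]; rewrite ?big_nil.
Qed.

Lemma gen_in_max j : M (fpsX ^+ m j).
Proof.
exists 1%N, (fun=> 1), (fun=> fpsX ^+ m j).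
by split=> [_|_|]; [exact: subring1 | exists j | rewrite big_ord1 mul1r].
Qed.

(** Each exponent n of f is charged to one generator m j that starts a long sum
    for n; [F j] collects the exponents charged to j, shifted down by m j. *)
Lemma supported_decomp i (f : fps R) : supported (sum_of_at_least i.+1) f ->
  exists F : 'I_r -> fps R, (forall j, supported (sum_of_at_least i) (F j)) /\
    f = \sum_j fpsX ^+ m j * F j.
Proof.
move=> Sf.
have /choice [J JP] n : exists o : option 'I_r, if o is Some j
    then (m j <= n)%N /\ sum_of_at_least i (n - m j) else f n = 0.
  have [f0|/Sf/sum_of_at_leastS [j jP]] := eqVneq (f n) 0; first by exists None.
  by exists (Some j).
exists (fun j n => if J (n + m j)%N == Some j then f (n + m j)%N else 0); split.
  move=> j n; case: (J _ =P _) => [Jn _|_]; last by rewrite eqxx.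
  by move: (JP (n + m j)%N); rewrite Jn addnK => -[].
apply/funext => n; rewrite fps_coef_sum.
case Jn: (J n) (JP n) => [j0|] => [[le_n _]|f0].
  rewrite (bigD1 j0) //= fps_coefXM le_n subnK // Jn eqxx big1 ?addr0 //.
  move=> j /negPf jj0; rewrite fps_coefXM; case: leqP => // le_jn.
  by rewrite subnK // Jn (inj_eq Some_inj) eq_sym jj0.
rewrite f0 big1 // => j _; rewrite fps_coefXM; case: leqP => // le_jn.
by rewrite subnK // Jn.
Qed.

(** Supports add under products, and conversely a decomposition along the
    generators lowers the required length by one. *)
Lemma ideal_powE i : ideal_pow A M i = supported (sum_of_at_least i).
Proof.
elim: i => [|i IH] /=; first exact: fps_subringE.
rewrite IH; apply/seteqP; split.
  have MS : M `<=` supported (sum_of_at_least 1).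
    apply: ideal_span_supported => _ [j ->].
    by apply: supportedXn; exact: sum_of_at_least_gen.
  apply: ideal_span_supported => _ [y My [z Sz ->]].
  by apply: supportedM (MS _ My) Sz; exact: (@sum_of_at_leastD 1 i).
move=> f /supported_decomp [F [SF fE]].
exists r, (fun=> 1), (fun j => fpsX ^+ m j * F j); split=> [_|j|].
- exact: subring1.
- by exists (fpsX ^+ m j); [exact: gen_in_max | exists (F j)].
- by rewrite fE; apply: eq_bigr => j _; rewrite mul1r.
Qed.

End SemigroupRing.

(** * Arithmetic progressions *)

Section Arithmetic.
Variables a b d : nat.
Hypotheses (d_gt0 : (0 < d)%N) (b_gt0 : (0 < b)%N).
Local Notation m0 := (3 * a + b)%N.
Local Notation gens := (fun j : 'I_4 => gen_exp a b d j).

Lemma sum_of_at_least_arith i n : sum_of_at_least gens i n <->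
  exists s t, [/\ (i <= s)%N, (t <= 3 * s)%N & n = (s * m0 + t * d)%N].
Proof.
split=> [[w lw ->]|[s [t [le_is]]]].
  exists (size w), (\sum_(j <- w) j)%N; split=> //.
    elim: w {lw} => [|j w IH]; first by rewrite big_nil.
    by rewrite big_cons /=; have := ltn_ord j; lia.
  elim: w {lw} => [|j w IH]; rewrite ?big_nil // !big_cons IH /gen_exp /=.
  by lia.
move=> le_t ->; suff [w lw wE] : sum_of_at_least gens s (s * m0 + t * d).
  by exists w; rewrite // (leq_trans le_is).
elim: s t {le_is} le_t => [|s IH] t le_t.
  by exists [::]; rewrite ?big_nil; lia.
(* use the largest available index, so that the rest t - j is at most 3s *)
have lt_j : (minn t 3 < 4)%N by lia.
have -> : (s.+1 * m0 + t * d = gen_exp a b d (Ordinal lt_j)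
           + (s * m0 + (t - minn t 3) * d))%N.
  rewrite /gen_exp /= mulnBl.
  by have := leq_mul (geq_minl t 3) (leqnn d); lia.
apply: (@sum_of_at_leastD _ _ 1 s); first exact: sum_of_at_least_gen.
by apply: (IH (t - minn t 3)%N); lia.
Qed.

Hypothesis m0d : coprime m0 d.

(** If t >= m0, the trade s m0 + t d = (s + d) m0 + (t - m0) d gives a longer
    sum. *)
Lemma sum_of_at_least_minimal i s t : (i <= s)%N -> (t <= 3 * s)%N ->
  ~ sum_of_at_least gens i.+1 (s * m0 + t * d) -> s = i /\ (t < m0)%N.
Proof.
move=> le_is le_t nS; split.
  apply/eqP; rewrite eqn_leq le_is andbT leqNgt; apply/negP => lt_is.
  by apply: nS; apply/sum_of_at_least_arith; exists s, t.
rewrite ltnNge; apply/negP => le_m0t.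
apply: nS; apply/sum_of_at_least_arith.
exists (s + d)%N, (t - m0)%N; split; [lia | lia |].
by rewrite mulnBl mulnDl; have := leq_mul le_m0t (leqnn d); lia.
Qed.

(** A longer sum s m0 + t d would give (s - i) m0 = (r - t) d > 0, so that m0
    divides r - t by coprimality, although 0 < r - t < m0. *)
Lemma not_sum_of_at_leastS i r : (r < m0)%N ->
  ~ sum_of_at_least gens i.+1 (i * m0 + r * d).
Proof.
move=> lt_r /sum_of_at_least_arith [s [t [lt_is _ E]]].
have E1 : ((s - i) * m0 = (r - t) * d)%N.
  by rewrite !mulnBl; lia.
have : (m0 %| (r - t) * d)%N by rewrite -E1 dvdn_mull.
rewrite Gauss_dvdl // => dv.
have rt0 : (r - t = 0)%N.
  by case: (posnP (r - t)) => // /dvdn_leq /(_ dv); lia.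
by move: E1; rewrite rt0 mul0n => /eqP; rewrite muln_eq0; lia.
Qed.

(** The monomials t^(i m0 + r d) with r <= 3i and r < m0 form a basis of m^i
    modulo m^(i+1): distinct r give distinct exponents, and these are the only
    exponents of m^i that are missing in m^(i+1). *)
Lemma hilbert_value_arith (k : fieldType) i :
  hilbert_value k a b d i (minn (3 * i).+1 m0).
Proof.
have g_gt0 (j : 'I_4) : (0 < gen_exp a b d j)%N by rewrite /gen_exp; lia.
rewrite /hilbert_value /arith_max /arith_ring !ideal_powE //.
set h := minn _ _.
pose p r := (i * m0 + r * d)%N.
have p_inj : injective p.
  move=> r1 r2 /addnI /eqP; rewrite eqn_pmul2r //; exact/eqP.
have coef (c : 'I_h -> k) n :
    (\sum_j c j *: fpsX ^+ p j : fps k) n = \sum_j c j * (n == p j)%:R.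
  by rewrite fps_coef_sum; apply: eq_bigr => j _; rewrite -fps_coefXn.
have coefp (c : 'I_h -> k) r :
    (\sum_j c j *: fpsX ^+ p j : fps k) (p r) = oapp c 0 (insub r).
  rewrite coef; case: insubP => [j _ <-|ge_r] /=.
    rewrite (bigD1 j) //= eqxx mulr1 big1 ?addr0 // => l /negPf lj.
    by rewrite (inj_eq p_inj) eq_sym (inj_eq val_inj) lj mulr0.
  rewrite big1 // => l _; rewrite (inj_eq p_inj).
  by case: eqP => [rl|]; rewrite ?mulr0 //; case/negP: ge_r; rewrite rl.
exists (fun j : 'I_h => fpsX ^+ p j); split.
- move=> j; apply: supportedXn; apply/sum_of_at_least_arith.
  by exists i, j; split=> //; have := ltn_ord j; rewrite /h; lia.
- move=> c Sc j; apply/eqP/negPn/negP => cj.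
  have := coefp c j; rewrite valK /= => cE.
  have /Sc : (\sum_j c j *: fpsX ^+ p j : fps k) (p j) != 0 by rewrite cE.
  by apply: not_sum_of_at_leastS; have := ltn_ord j; rewrite /h; lia.
move=> x Sx; exists (fun j => x (p j)) => n nz; apply: contrapT => nS.
case/negP: nz; apply/eqP; rewrite fps_coefD.
rewrite -[(- _) n]/(- (\sum_(j < h) x (p j) *: fpsX ^+ p j : fps k) n).
have [xn0|xn] := eqVneq (x n) 0.
  rewrite xn0 sub0r coef big1 ?oppr0 // => j _.
  by case: eqP => [<-|]; rewrite ?mulr0 // xn0 mul0r.
have /sum_of_at_least_arith [s [t [le_is le_t nE]]] := Sx n xn.
rewrite {}nE in nS xn *.
have [si lt_t] := sum_of_at_least_minimal le_is le_t nS.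
rewrite {}si in le_t *; rewrite -/(p t) coefp.
have lt_th : (t < h)%N by rewrite /h; lia.
by rewrite insubT subrr.
Qed.

End Arithmetic.

(** * The numerical identities *)

Lemma binz3_lt3 (z : int) : z < 3 -> binz3 z = 0.
Proof. by case: z => // -[|[|[|n]]]. Qed.

Lemma binz3E (z : int) : 0 <= z -> 6 * binz3 z = z * (z - 1) * (z - 2).
Proof.
case: z => // -[|[|n]] _ //=.
have := bin_ffact n.+2 3; rewrite !ffactnS ffactn0 muln1 /= -[3`!]/6%N.
by move/(congr1 Posz); rewrite !PoszM => E; lia.
Qed.

Theorem corollary3p3 (k : fieldType) (a b d : nat)
    (a_ge1 : (1 <= a)%N) (d_ge1 : (1 <= d)%N) (b_123 : b \in [:: 1; 2; 3]%N)
    (gcd1 : gcdn (gcdn (gen_exp a b d 0) (gen_exp a b d 1))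
                 (gcdn (gen_exp a b d 2) (gen_exp a b d 3)) = 1%N)
    (i : nat) :
  exists2 h : nat, hilbert_value k a b d i h &
    [/\ b = 1%N ->
          h%:Z = binz3 (i%:Z + 3) - 3 * binz3 (i%:Z + 1)
                 - 3 * binz3 (i%:Z - a%:Z + 2) + 2 * binz3 i%:Z
                 + 6 * binz3 (i%:Z - a%:Z + 1) - 3 * binz3 (i%:Z - a%:Z),
        b = 2%N ->
          h%:Z = binz3 (i%:Z + 3) - 3 * binz3 (i%:Z + 1)
                 - 2 * binz3 (i%:Z - a%:Z + 2) + 2 * binz3 i%:Z
                 + 3 * binz3 (i%:Z - a%:Z + 1) - binz3 (i%:Z - a%:Z - 1)
      & b = 3%N ->
          h%:Z = binz3 (i%:Z + 3) - 3 * binz3 (i%:Z + 1)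
                 - binz3 (i%:Z - a%:Z + 2) + 2 * binz3 i%:Z
                 + 3 * binz3 (i%:Z - a%:Z) - 2 * binz3 (i%:Z - a%:Z - 1)].
Proof.
have b_gt0 : (0 < b)%N by move: b_123; rewrite !inE; lia.
have m0d : coprime (3 * a + b) d.
  have dv j : (gcdn (3 * a + b) d %| gen_exp a b d j)%N.
    by rewrite /gen_exp dvdn_add ?dvdn_gcdl // dvdn_mull // dvdn_gcdr.
  by rewrite /coprime -dvdn1 -[X in (_ %| X)%N]gcd1 !dvdn_gcd !dv.
exists (minn (3 * i).+1 (3 * a + b)); first exact: hilbert_value_arith.
have P3 := @binz3E (i%:Z + 3) isT; have P1 := @binz3E (i%:Z + 1) isT.
have P0 := @binz3E i%:Z isT.
have [lt_ia|[j iE]] : (i < a)%N \/ exists j, i = (a + j)%N.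
  by case: (ltnP i a) => [|/subnKC <-]; [left | right; exists (i - a)%N].
- rewrite (@binz3_lt3 (_ - _)) ?(@binz3_lt3 (_ - _ + _))
          ?(@binz3_lt3 (_ - _ - _)); try lia.
  by split=> bE; lia.
have -> : i%:Z - a%:Z = j%:Z by lia.
have [j0|j_gt0] := posnP j.
  (* i - a - 1 is negative here, so the polynomial formula does not apply *)
  rewrite {}j0 in iE *.
  by rewrite !(@binz3_lt3 (0%:Z + _)) ?(@binz3_lt3 (0%:Z - 1))
             ?(@binz3_lt3 0%:Z) //; split=> bE; lia.
have Q2 := @binz3E (j%:Z + 2) isT; have Q1 := @binz3E (j%:Z + 1) isT.
have Q0 := @binz3E j%:Z isT; have Qm : 0 <= j%:Z - 1 by lia.
have {}Qm := binz3E Qm.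
by split=> bE; lia.
Qed.
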